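(* Let $k\geq 1$, let $P_{2k+1}$ be the path with $2k+1$ vertices and let $H$ be a graph. Then the lexicographic product $P_{2k+1}[H]$ is hamiltonian connected if and only if $\pi(H)\geq 2$ and $\left\lceil\frac{|H|+1}{\pi(H)}\right\rceil\leq k+1$.
   Context: The lexicographic product $G[H]$ has vertex set $V(G)\times V(H)$, with $(g,h)(g',h')$ an edge iff $gg'\in E(G)$, or $g=g'$ and $hh'\in E(H)$. $|H|$ is the number of vertices of $H$. $\pi(H)$ is the maximum number of edges of a spanning linear forest of $H$ (a forest whose components are paths). A graph is hamiltonian connected if every two vertices are joined by a hamiltonian path. *)

(* Defs.v *)
From mathcomp Require Import all_boot all_order all_algebra.

Set Implicit Arguments.
Unset Strict Implicit.
Unset Printing Implicit Defensive.

Record sgraph := SGraph {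
  vertex :> finType;
  adj : rel vertex;
  adj_sym : symmetric adj;
  adj_irrefl : irreflexive adj }.

Definition edges (G : sgraph) : {set {set G}} :=
  [set [set x; y] | x in G, y in G & adj x y].

Definition path_adj (n : nat) : rel 'I_n :=
  fun i j => (i.+1 == j) || (j.+1 == i).

Lemma path_adj_sym n : symmetric (@path_adj n).
Proof. by move=> i j; rewrite /path_adj orbC. Qed.

Lemma path_adj_irrefl n : irreflexive (@path_adj n).
Proof. by move=> i; rewrite /path_adj orbb gtn_eqF. Qed.

Definition path_graph (n : nat) : sgraph :=
  SGraph (@path_adj_sym n) (@path_adj_irrefl n).

Definition lex_adj (G H : sgraph) : rel (G * H) :=
  fun u v => adj u.1 v.1 || ((u.1 == v.1) && adj u.2 v.2).

Lemma lex_adj_sym G H : symmetric (@lex_adj G H).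
Proof.
by move=> u v; rewrite /lex_adj (adj_sym u.1) (adj_sym u.2) (eq_sym u.1).
Qed.

Lemma lex_adj_irrefl G H : irreflexive (@lex_adj G H).
Proof. by move=> u; rewrite /lex_adj !adj_irrefl andbF. Qed.

Definition lex_product (G H : sgraph) : sgraph :=
  SGraph (@lex_adj_sym G H) (@lex_adj_irrefl G H).

Definition hamiltonian_path (G : sgraph) (x y : G) (p : seq G) : Prop :=
  [/\ path (@adj G) x p, last x p = y, uniq (x :: p)
    & forall z : G, z \in x :: p].

Definition hamiltonian_connected (G : sgraph) : Prop :=
  forall x y : G, x != y -> exists p : seq G, hamiltonian_path x y p.

(* A spanning subgraph of a graph on T is given by its set F of edges. *)
Definition edge_rel (T : finType) (F : {set {set T}}) : rel T :=
  fun x y => [set x; y] \in F.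

Definition component (T : finType) (F : {set {set T}}) (x : T) : {set T} :=
  [set y | connect (edge_rel F) x y].

(* The subgraph of (T, F) induced on A is isomorphic to the path on #|A|
   vertices. *)
Definition induces_path (T : finType) (F : {set {set T}}) (A : {set T}) : bool :=
  [exists f : {ffun 'I_#|A| -> T},
    [&& injectiveb f, f @: [set: 'I_#|A|] == A &
      [forall i, forall j, edge_rel F (f i) (f j) == path_adj i j]]].

(* Acyclicity needs no separate clause: a cycle lies in a single component. *)
Definition linear_forest (T : finType) (F : {set {set T}}) : bool :=
  [forall x, induces_path F (component F x)].

(* The number pi(H); the empty edge set is always admissible. *)
Definition max_linear_forest (H : sgraph) : nat :=
  \max_(F : {set {set H}} | (F \subset edges H) && linear_forest F) #|F|.

(* Main.v *)
Require Import Defs.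
From mathcomp Require Import all_boot all_order all_algebra.
From mathcomp Require Import zify.

(** Write n = |H| and p = pi(H).  The number p is the largest number of
    consecutive adjacent pairs in a linear ordering of the vertices of H, and a
    column (copy of H) traversed by a hamiltonian path in r blocks uses n - r of
    its edges.

    Necessity: take both ends in column 1.  The kn vertices of the odd columns cut
    the path into at most kn - 1 pieces inside single even columns, so the k + 1
    even columns, with (k+1)n vertices, use at least n + 1 edges, whence
    n + 1 <= (k+1)p.  Column 0 is entered and left through column 1 only, and
    column 1 is also entered from column 2, so column 0 uses at least two edges.

    Sufficiency: let the ends lie in columns a <= b.  Forcing given ends on an
    ordering of H costs at most one edge per end.  Choose s_0, ..., s_k <= p of sum
    n + 1 and let column 2j have n - s_j + [2j = a] + [2j = b] blocks and each odd
    column n singleton blocks.  A walk with these numbers of visits is obtained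
    from a, ..., 0, ..., 2k, ..., b by inserting detours i, i+1, i, and its visits
    are then filled with the blocks. *)

Set Implicit Arguments.
Unset Strict Implicit.
Unset Printing Implicit Defensive.

(** * Adjacent consecutive pairs in a sequence *)

Fixpoint nadj (T : Type) (e : rel T) (s : seq T) : nat :=
  if s is x :: s' then
    (if s' is y :: _ then nat_of_bool (e x y) else 0) + nadj e s'
  else 0.

(** Only the pair at the junction lies in neither part. *)
Lemma nadj_cat (T : Type) (e : rel T) (s t : seq T) :
  nadj e s + nadj e t <= nadj e (s ++ t) <= nadj e s + nadj e t + 1.
Proof.
elim: s => [|x [|y s] IH] //=; first by rewrite add0n; lia.
  by case: t {IH} => [|z t] //=; case: (e x z); lia.
by move: IH => /=; lia.
Qed.

Lemma nadj_rcons (T : Type) (e : rel T) (s : seq T) (x y : T) :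
  nadj e (rcons (rcons s x) y) = nadj e (rcons s x) + e x y.
Proof.
elim: s => [|a [|b s] IH] /=; first by rewrite !addn0.
  by lia.
by move: IH => /=; lia.
Qed.

Lemma nadj_rev (T : Type) (e : rel T) (s : seq T) :
  symmetric e -> nadj e (rev s) = nadj e s.
Proof.
move=> esym; elim: s => [|x [|y s] IH] //.
by rewrite rev_cons rev_cons nadj_rcons -rev_cons IH esym /=; lia.
Qed.

Lemma nadj_leq_size (T : Type) (e : rel T) (x : T) (s : seq T) :
  nadj e (x :: s) <= size s.
Proof.
elim: s x => [|y s IH] x //=; have := IH y => /=.
by case: (e x y); lia.
Qed.

(** * Vertex orderings and linear forests *)

Fixpoint consec_edges (T : finType) (e : rel T) (s : seq T) : seq {set T} :=
  if s is x :: s' then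
    (if s' is y :: _ then if e x y then [:: [set x; y]] else [::] else [::])
      ++ consec_edges e s'
  else [::].

Lemma size_consec_edges (T : finType) (e : rel T) (s : seq T) :
  size (consec_edges e s) = nadj e s.
Proof.
by elim: s => [|x [|y s] IH] //=; rewrite size_cat IH; case: (e x y).
Qed.

Lemma consec_edgesP (T : finType) (e : rel T) (x0 : T) (s : seq T) (A : {set T}) :
  reflect (exists i, [/\ i.+1 < size s, e (nth x0 s i) (nth x0 s i.+1)
                       & A = [set nth x0 s i; nth x0 s i.+1]])
          (A \in consec_edges e s).
Proof.
apply: (iffP idP).
  elim: s => [|x [|y s] IH] //=; rewrite mem_cat => /orP[|/IH[i [lt_i exy ->]]].
    by case: ifP => // exy; rewrite inE => /eqP ->; exists 0.
  by exists i.+1.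
case=> i [lt_i exy ->]; elim: s i lt_i exy => [|x [|y s] IH] [|i] //= lt_i exy.
  by rewrite exy mem_cat inE eqxx.
by rewrite mem_cat (IH i) ?orbT.
Qed.

Lemma consec_edges_uniq (T : finType) (e : rel T) (s : seq T) :
  uniq s -> uniq (consec_edges e s).
Proof.
elim: s => [|x [|y s] IH] //; rewrite cons_uniq => /andP[xs us].
have -> : consec_edges e [:: x, y & s] =
    (if e x y then [:: [set x; y]] else [::]) ++ consec_edges e (y :: s) by [].
rewrite cat_uniq IH // andbT; case: ifP => [_|_]; last by apply/hasP => -[].
apply/hasP => -[A /(consec_edgesP _ x)[i [lt_i _ ->]]]; rewrite inE => /eqP exy.
have: x \in [set x; y] by rewrite !inE eqxx.
rewrite -exy !inE => /orP[] /eqP xE; move: xs; rewrite xE.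
  by rewrite mem_nth // (ltnW lt_i).
by rewrite mem_nth.
Qed.

Lemma eq_set2 (T : finType) (a b c d : T) :
  [set a; b] = [set c; d] -> (a = c /\ b = d) \/ (a = d /\ b = c).
Proof.
move=> E.
have: a \in [set c; d] by rewrite -E !inE eqxx.
have: b \in [set c; d] by rewrite -E !inE eqxx orbT.
have: c \in [set a; b] by rewrite E !inE eqxx.
have: d \in [set a; b] by rewrite E !inE eqxx orbT.
rewrite !inE => /orP[]/eqP ? /orP[]/eqP ? /orP[]/eqP ? /orP[]/eqP ?; subst; auto.
Qed.

Lemma edge_rel_sym (T : finType) (F : {set {set T}}) : symmetric (edge_rel F).
Proof. by move=> x y; rewrite /edge_rel setUC. Qed.

(** In terms of positions in [s], edges join neighbouring positions, so a component occupies an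
    interval of positions and induces a path on it. *)
Lemma consec_linear_forest (T : finType) (e : rel T) (s : seq T) :
  uniq s -> (forall z, z \in s) -> linear_forest [set A in consec_edges e s].
Proof.
move=> us fs; set F := [set A in _]; apply/forallP => z.
pose ix u := index u s.
have ixlt u : ix u < size s by rewrite index_mem.
have nix u : nth z s (ix u) = u by rewrite nth_index.
have ixn i : i < size s -> ix (nth z s i) = i by move=> lt_i; exact: index_uniq.
have FP u v : edge_rel F u v ->
  exists2 i, i.+1 < size s /\ e (nth z s i) (nth z s i.+1)
    & (ix u = i /\ ix v = i.+1) \/ (ix v = i /\ ix u = i.+1).
  rewrite /edge_rel inE => /(consec_edgesP _ z)[i [lt_i eii E]]; exists i => //.
  case: (eq_set2 E) => -[-> ->]; rewrite !ixn ?(ltnW lt_i) //; by [left|right].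
(* If the pair at [i] is not an edge, the positions up to [i] form a closed set, and no connection
   leads from there to a later position. *)
have cross u v i : connect (edge_rel F) u v -> ix u <= i < ix v ->
    edge_rel F (nth z s i) (nth z s i.+1).
  move=> cuv /andP[ui iv]; apply/negPn/negP => Fii.
  have cl : closed (edge_rel F) [pred w | ix w <= i].
    move=> a b /FP[j [lt_j ej] ab]; rewrite !inE.
    have ji : j != i.
      apply: contra Fii => /eqP <-; rewrite /edge_rel inE.
      by apply/(consec_edgesP _ z); exists j.
    by move: ab ji; lia.
  have := closed_connect cl cuv; rewrite !inE ui => /esym.
  by rewrite leqNgt iv.
have csym := sym_connect_sym (@edge_rel_sym _ F).
set A := component F z.
have zA : z \in A by rewrite inE connect0.
have AA u v : u \in A -> v \in A -> connect (edge_rel F) u v.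
  by rewrite !inE => zu zv; apply: connect_trans zv; rewrite csym.
(* The component consists of all positions from [lo] to [hi], because [cross] supplies every edge in
   between. *)
pose lo := [arg min_(u < z in A) ix u]; pose hi := [arg max_(u > z in A) ix u].
have [loA loP] : lo \in A /\ forall u, u \in A -> ix lo <= ix u.
  by rewrite /lo; case: arg_minnP.
have [hiA hiP] : hi \in A /\ forall u, u \in A -> ix u <= ix hi.
  by rewrite /hi; case: arg_maxnP.
have inA i : ix lo <= i <= ix hi -> nth z s i \in A.
  elim: i => [|i IH] /andP[le1 le2].
    by rewrite (_ : 0 = ix lo) ?nix //; lia.
  have [->|ne] := eqVneq i.+1 (ix lo); first by rewrite nix.
  have le3 : ix lo <= i by lia.
  have := IH; rewrite le3 (ltnW le2) => /(_ isT).
  rewrite !inE => zi; apply: connect_trans zi (connect1 _).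
  by apply: (cross lo hi) => //; [exact: AA | lia].
have le_lohi : ix lo <= ix hi by exact: loP.
pose N := (ix hi - ix lo).+1.
pose g i := nth z s (ix lo + i).
have lt_size i : i < N -> ix lo + i < size s.
  by have := ixlt hi; rewrite /N; lia.
have ginj i j : i < N -> j < N -> g i = g j -> i = j.
  move=> iN jN /(congr1 ix); rewrite /g !ixn; try exact: lt_size.
  by lia.
have gA k : k < N -> g k \in A by move=> kN; apply: inA; move: kN; rewrite /N; lia.
have AE : A = [set g (val i) | i in [set: 'I_N]].
  apply/setP => u; apply/idP/imsetP => [uA|[i _ ->]].
    have ltN : ix u - ix lo < N by have := hiP _ uA; have := loP _ uA; rewrite /N; lia.
    exists (Ordinal ltN) => //; rewrite -[LHS]nix /g; congr nth.
    by have := loP _ uA; rewrite /=; lia.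
  by apply: inA; have := ltn_ord i; rewrite /N /=; lia.
have cardA : #|A| = N.
  rewrite AE card_imset ?cardsT ?card_ord // => i j E.
  by apply: val_inj; apply: ginj (ltn_ord i) (ltn_ord j) E.
apply/existsP; rewrite -/A.
exists [ffun i : 'I_#|A| => g i]; apply/and3P; split.
- apply/injectiveP => i j; rewrite !ffunE => E.
  by apply: val_inj; apply: ginj E; rewrite -cardA; exact: ltn_ord.
- rewrite eqEcard; apply/andP; split.
    apply/subsetP => _ /imsetP[i _ ->]; rewrite ffunE; apply: gA.
    by rewrite -cardA; exact: ltn_ord.
  rewrite card_imset ?cardsT ?card_ord // => i j; rewrite !ffunE => E.
  by apply: val_inj; apply: ginj E; rewrite -cardA; exact: ltn_ord.
apply/forallP => i; apply/forallP => j; rewrite !ffunE.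
have iN : i < N by rewrite -cardA. 
have jN : j < N by rewrite -cardA.
have ixg k : k < N -> ix (g k) = ix lo + k by move=> kN; rewrite /g ixn ?lt_size.
have step k : k.+1 < N -> edge_rel F (g k) (g k.+1).
  move=> kN; rewrite {2}/g addnS; apply: (cross (g k) (g k.+1)).
    by apply: AA; apply: gA; lia.
  by rewrite !ixg; lia.
apply/eqP; apply/idP/idP; last first.
  case/orP => /eqP E; first by rewrite -E; apply: step; rewrite E.
  by rewrite edge_rel_sym -E; apply: step; rewrite E.
by case/FP => l _; rewrite !ixg // /path_adj; lia.
Qed.

Lemma nadj_leq_max_linear_forest (H : sgraph) (s : seq H) :
  uniq s -> (forall z, z \in s) -> nadj (@adj H) s <= max_linear_forest H.
Proof.
move=> us fs; pose F := [set A in consec_edges (@adj H) s].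
have <- : #|F| = nadj (@adj H) s.
  by rewrite -size_consec_edges cardsE; apply/card_uniqP/consec_edges_uniq.
apply: (@leq_bigmax_cond _ _ (fun F : {set {set H}} => #|F|)).
rewrite consec_linear_forest // andbT; apply/subsetP => A; rewrite inE.
case: s {us fs F} => [|x s] // /(consec_edgesP _ x)[i [_ exy ->]].
by apply/imset2P; exists (nth x (x :: s) i) (nth x (x :: s) i.+1); rewrite ?inE.
Qed.

(** Induction on [#|S|]: the component of an element of [S] is listed along its path, and removing
    it leaves a closed set. This is why [S] is an arbitrary closed set and not the whole type. *)
Lemma linear_forest_ordering (T : finType) (F : {set {set T}}) (x0 : T) (S : {set T}) :
    linear_forest F -> closed (edge_rel F) (mem S) ->
  exists s, [/\ uniq s, s =i S & forall u v, u \in S -> edge_rel F u v ->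
    exists2 i, i.+1 < size s & [set u; v] = [set nth x0 s i; nth x0 s i.+1]].
Proof.
move=> lF; have [N] := ubnP #|S|; elim: N S => // N IH S leN clS.
have [->|[z zS]] := set_0Vmem S.
  by exists [::]; split => // [u|u v]; rewrite inE.
set A := component F z.
have csym := sym_connect_sym (@edge_rel_sym _ F).
have clA : closed (edge_rel F) (mem A).
  move=> a b ab; rewrite /= !inE; apply/idP/idP => zc; apply: connect_trans zc (connect1 _) => //.
  by rewrite edge_rel_sym.
have AS : A \subset S.
  by apply/subsetP => u; rewrite inE => zu; have := closed_connect clS zu; rewrite /= zS => <-.
have zA : z \in A by rewrite inE connect0.
have [||s [us sE sP]] := IH (S :\: A).
- apply: (@leq_trans #|S|); [apply: proper_card | exact: leN].
  apply/properP; split; first exact: subsetDl.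
  by exists z; rewrite // !inE connect0.
- by move=> a b ab; have := clS _ _ ab; have := clA _ _ ab; rewrite /= !in_setD => -> ->.
have /forallP/(_ z)/existsP[f /and3P[/injectiveP finj /eqP fA /forallP fe]] := lF.
rewrite -/A in f finj fA fe.
pose t := [seq f i | i <- enum 'I_#|A|].
have st : size t = #|A| by rewrite size_map size_enum_ord.
have tE : t =i A.
  move=> u; rewrite -fA; apply/mapP/imsetP => -[i _ ->]; exists i => //.
  by rewrite mem_enum.
have nt (i : 'I_#|A|) : nth x0 t i = f i.
  by rewrite (nth_map i) ?size_enum_ord // nth_ord_enum.
exists (t ++ s); split.
- rewrite cat_uniq us map_inj_uniq ?enum_uniq //= andbT.
  by apply/hasPn => u; rewrite sE in_setD => /andP[uA _]; rewrite /= tE.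
- move=> u; rewrite mem_cat tE sE in_setD.
  by case uA : (u \in A) => //=; rewrite (subsetP AS).
move=> u v uS uv; case uA : (u \in A); last first.
  have [||i lt_i ->] := sP u v => //; first by rewrite in_setD uA.
  exists (size t + i); first by rewrite size_cat -addnS ltn_add2l.
  by rewrite -addnS !nth_cat !ltnNge !leq_addr /= !addKn.
have vA : v \in A by have := clA _ _ uv; rewrite /= uA.
move: uA vA; rewrite -fA => /imsetP[i _ uE] /imsetP[j _ vE].
have /forallP/(_ j)/eqP := fe i; rewrite -uE -vE uv => /esym/orP[] /eqP E.
  exists i; first by rewrite size_cat st E ltn_addr.
  by rewrite !nth_cat st !ltn_ord E ltn_ord !nt uE vE.
exists j; first by rewrite size_cat st E ltn_addr.
by rewrite !nth_cat st !ltn_ord E ltn_ord !nt uE vE setUC.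
Qed.

(** Converse to [nadj_leq_max_linear_forest]: when the components of a maximum forest are listed one
    after another, each of its edges joins consecutive entries. *)
Lemma max_linear_forest_ordering (H : sgraph) : 0 < #|H| ->
  exists s : seq H, perm_eq s (enum H) /\ max_linear_forest H <= nadj (@adj H) s.
Proof.
case/card_gt0P => x0 _.
rewrite /max_linear_forest.
have [|F /andP[FE lF] ->] := @eq_bigmax_cond _
  [pred F : {set {set H}} | (F \subset edges H) && linear_forest F] (fun F => #|F|).
  (* The maximum is attained once some edge set is admissible; the empty one is the set of
     consecutive edges of the empty relation. *)
  apply/card_gt0P; exists set0; rewrite inE sub0set /=.
  have <- : [set A in consec_edges (fun _ _ : H => false) (enum H)] = set0.
    by apply/setP => A; rewrite !inE; apply/negP => /(consec_edgesP _ x0)[i []].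
  by apply: consec_linear_forest; rewrite ?enum_uniq // => z; rewrite mem_enum.
have clT : closed (edge_rel F) (mem [set: H]) by move=> a b _; rewrite /= !inE.
have [s [us sE sP]] := linear_forest_ordering x0 lF clT.
exists s; split.
  by apply: uniq_perm; rewrite ?enum_uniq // => z; rewrite sE mem_enum inE.
rewrite -size_consec_edges -(card_uniqP (consec_edges_uniq (@adj H) us)).
apply/subset_leq_card/subsetP => A AF.
have := subsetP FE _ AF => /imset2P[u v _]; rewrite inE /= => uv AE.
have [||i lt_i E] := sP u v; rewrite ?inE // /edge_rel -?AE //.
apply/(consec_edgesP _ x0); exists i; rewrite lt_i AE E; split => //.
by case: (eq_set2 E) => -[<- <-] //; rewrite adj_sym.
Qed.

Lemma max_linear_forest_lt (H : sgraph) : 0 < #|H| -> max_linear_forest H < #|H|.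
Proof.
move=> H0; have [s [/perm_size ss]] := max_linear_forest_ordering H0.
move=> /leq_ltn_trans; apply; rewrite -cardE in ss; move: H0; rewrite -ss.
by case: s {ss} => [|a t _]; [| exact: nadj_leq_size].
Qed.

(** * Double counting of the steps of a path *)

Lemma count_belast (T : Type) (P : pred T) (x : T) (s : seq T) :
  count P (belast x s) + P (last x s) = count P (x :: s).
Proof. by rewrite lastI -cats1 count_cat /= addn0. Qed.

(** Both sides count the consecutive pairs that do not enter [P] from its complement. *)
Lemma nadj_count (T : Type) (P : pred T) (x : T) (s : seq T) :
  nadj (fun u v => P u && P v) (x :: s) + count (predC P) s =
  count P (belast x s) + nadj (fun u v => ~~ P u && ~~ P v) (x :: s).
Proof.
elim: s x => [|y s IH] x //=; have := IH y => /=.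
by case: (P x); case: (P y) => /=; lia.
Qed.

Lemma nadj_count_from (T : Type) (e : rel T) (P Q : pred T) (x : T) (s : seq T) :
    (forall u v, e u v -> P u -> P v (+) Q v) -> path e x s ->
  nadj (fun u v => P u && P v) (x :: s) + nadj (fun u v => P u && Q v) (x :: s)
    = count P (belast x s).
Proof.
move=> ePQ; elim: s x => [|y s IH] x //= /andP[exy /IH].
have := ePQ _ _ exy; rewrite /=.
by case: (P x) => [/(_ isT)|_]; case: (P y); case: (Q y) => //=; lia.
Qed.

Lemma nadj_count_to (T : Type) (P Q : pred T) (x : T) (s : seq T) :
  nadj (fun u v => P u && Q v) (x :: s) + nadj (fun u v => ~~ P u && Q v) (x :: s)
    = count Q s.
Proof.
elim: s x => [|y s IH] x //=; have := IH y => /=.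
by case: (P x); case: (Q y) => /=; lia.
Qed.

(** * Columns of the product and necessity *)

Definition column (N : nat) (H : sgraph) (u : lex_product (path_graph N) H) : nat :=
  nat_of_ord u.1.

Lemma column_inj (N : nat) (H : sgraph) (u v : lex_product (path_graph N) H) :
  column u = column v -> u.1 = v.1.
Proof. exact: val_inj. Qed.

Lemma lex_path_adjP (N : nat) (H : sgraph) (u v : lex_product (path_graph N) H) :
  adj u v -> [\/ (column u).+1 = column v, (column v).+1 = column u
               | column u = column v /\ adj u.2 v.2].
Proof.
case/orP => [/orP[]/eqP|/andP[/eqP E a2]]; [by constructor 1|by constructor 2|].
by constructor 3; rewrite /column E.
Qed.

(** A step changes the column by at most one, so a step between even columns stays in a single
    column. *)
Lemma nadj_column_sum (N : nat) (H : sgraph) (x : lex_product (path_graph N) H)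
    (s : seq (lex_product (path_graph N) H)) :
  path (@adj _) x s ->
  nadj (fun u v => ~~ odd (column u) && ~~ odd (column v)) (x :: s) <=
  \sum_(i < N | ~~ odd i) nadj (fun u v => (column u == i) && (column v == i)) (x :: s).
Proof.
elim: s x => [|y s IH] x //.
have E e : nadj e [:: x, y & s] = e x y + nadj e (y :: s) by [].
under eq_bigr do rewrite E; rewrite E big_split /=.
case/andP => /lex_path_adjP exy /IH; apply: leq_add.
case: (boolP (~~ odd _ && _)) => // /andP[ex ey].
have Exy : column x = column y by case: exy => [||[]]; lia.
by rewrite (bigD1 x.1) //= -Exy eqxx.
Qed.

(** Consecutive entries in column [i] stay consecutive after filtering and are adjacent in [H].
    Filtering may bring further adjacent pairs together, hence only an inequality. *)
Lemma nadj_column_filter (N : nat) (H : sgraph) (i : nat)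
    (x : lex_product (path_graph N) H) (s : seq (lex_product (path_graph N) H)) :
  path (@adj _) x s ->
  nadj (fun u v => (column u == i) && (column v == i)) (x :: s) <=
  nadj (@adj H) [seq u.2 | u <- x :: s & column u == i].
Proof.
elim: s x => [|y s IH] x; first by case: (column x == i).
case/andP => /lex_path_adjP exy /IH{IH}.
have -> : [seq u.2 | u <- [:: x, y & s] & column u == i] =
   (if column x == i then [:: x.2] else [::]) ++ [seq u.2 | u <- y :: s & column u == i].
  by rewrite /=; case: (column x == i).
have -> e : nadj e [:: x, y & s] = e x y + nadj e (y :: s) by [].
set n1 := nadj _ (y :: s); case: (eqVneq (column x) i) => //= xi.
case: (eqVneq (column y) i) => [yi|_] /=; last by lia.
suff -> : adj x.2 y.2 by [].
by case: exy => [||[]] //; lia.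
Qed.

Lemma count_columns (N : nat) (H : sgraph) (s : seq (lex_product (path_graph N) H))
    (A : pred nat) :
    uniq s -> (forall z, z \in s) ->
  count (fun u => A (column u)) s = #|[pred i : 'I_N | A i]| * #|H|.
Proof.
move=> uniq_s full_s.
have /permP -> : perm_eq s (enum (('I_N * H)%type : finType)).
  by apply: uniq_perm; rewrite ?enum_uniq // => z; rewrite mem_enum full_s.
rewrite -cardX cardE -size_filter; congr size.
by rewrite enumT /enum_mem; apply: eq_filter => u; rewrite !inE andbT.
Qed.

Lemma nadj_column_leq (N : nat) (H : sgraph) (x : lex_product (path_graph N) H)
    (s : seq (lex_product (path_graph N) H)) (i : 'I_N) :
    path (@adj _) x s -> uniq (x :: s) -> (forall z, z \in x :: s) ->
  nadj (fun u v => (column u == i) && (column v == i)) (x :: s) <= max_linear_forest H.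
Proof.
move=> path_s uniq_s full_s.
apply: leq_trans (nadj_column_filter i path_s) _.
apply: nadj_leq_max_linear_forest => [|z].
  rewrite map_inj_in_uniq ?filter_uniq // => u v.
  rewrite !mem_filter => /andP[/eqP ui _] /andP[/eqP vi _] uv.
  have : u.1 = v.1 by apply: column_inj; rewrite ui vi.
  by case: u v uv {ui vi} => u1 u2 [v1 v2] /= -> ->.
by apply/mapP; exists (i, z) => //; rewrite mem_filter eqxx full_s.
Qed.

Lemma card_ord_even (k : nat) : #|[pred i : 'I_(2 * k + 1) | ~~ odd i]| = k.+1.
Proof.
rewrite -sum1_card big_mkcond /= (eq_bigr (fun i : 'I__ => nat_of_bool (~~ odd i))).
  rewrite -(big_mkord xpredT (fun i => nat_of_bool (~~ odd i))).
  elim: k => [|k IH]; first by rewrite muln0 big_nat1.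
  by rewrite (_ : 2 * k.+1 + 1 = (2 * k + 1).+2) 2?big_nat_recr //= ?IH; lia.
by move=> i _; rewrite inE; case: (odd i).
Qed.

Lemma card_ord_odd (k : nat) : #|[pred i : 'I_(2 * k + 1) | odd i]| = k.
Proof.
have := cardC [pred i : 'I_(2 * k + 1) | ~~ odd i].
rewrite card_ord_even card_ord => E.
have -> : #|[pred i : 'I_(2 * k + 1) | odd i]| =
          #|[predC [pred i : 'I_(2 * k + 1) | ~~ odd i]]|.
  by apply: eq_card => i; rewrite !inE negbK.
by apply: (@addnI k.+1); rewrite [LHS]E; lia.
Qed.

(** Since columns change by at most one per step, the path first leaves the columns above 1 by a
    step into column 1. *)
Lemma nadj_down (N : nat) (H : sgraph) (x : lex_product (path_graph N) H)
    (s : seq (lex_product (path_graph N) H)) :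
    path (@adj _) x s -> 1 < column x -> column (last x s) = 1 ->
  0 < nadj (fun u v => ~~ (column u == 0) && (column v == 1)) (x :: s).
Proof.
elim: s x => [|y s IH] x; first by move=> _ /= ? ?; lia.
have -> e : nadj e [:: x, y & s] = e x y + nadj e (y :: s) by [].
case/andP => /lex_path_adjP exy ps x1 l1.
have [y1|y1] := ltnP 1 (column y); first by rewrite ltn_addl // IH.
suff -> : ~~ (column x == 0) && (column y == 1) by [].
by case: exy => [||[]]; lia.
Qed.

(** With [n = #|H|], the [n] steps starting in column 0 end in column 0 or 1. Only
    [n - (column x == 1)] steps end in column 1, at least one of them not from column 0; the rest of
    the [n] steps stay in column 0. The case [column x = 0] serves to exclude [#|H| = 1]. *)
Lemma hamiltonian_path_max_linear_forest (N : nat) (H : sgraph)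
    (x y : lex_product (path_graph N) H) (s : seq (lex_product (path_graph N) H)) :
    2 < N -> column x <= 1 -> column y = 1 -> hamiltonian_path x y s ->
  (column x == 1).+1 <= max_linear_forest H.
Proof.
move=> N2 x1 y1 [ps ls us fs]; have N1 : 1 < N by lia.
have N0 : 0 < N by lia.
have := nadj_column_leq (Ordinal N0) ps us fs.
pose P (u : lex_product (path_graph N) H) := column u == 0.
pose Q (u : lex_product (path_graph N) H) := column u == 1.
have down : 0 < nadj (fun u v => ~~ P u && Q v) (x :: s).
  (* As [x] lies in column 0 or 1, this vertex of column 2 comes after it, and from there the path
     has to come down to [y]. *)
  have: ((Ordinal N2 : path_graph N), x.2) \in s.
    have := fs (Ordinal N2, x.2); rewrite inE => /orP[/eqP E|//].
    by move: x1; rewrite -E.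
  move=> zs; case/splitPr: zs ps ls {us fs} => s1 s2 ps ls.
  move: ps; rewrite cat_path => /andP[_ /andP[_ ps2]].
  have := nadj_down ps2 isT; rewrite last_cat /= in ls; rewrite ls => /(_ y1).
  have /andP[+ _] := nadj_cat (fun u v => ~~ P u && Q v) (x :: s1) 
     ((Ordinal N2 : path_graph N, x.2) :: s2).
  by move=> le1 lt1; apply: leq_trans (leq_trans lt1 (leq_addl _ _)) le1.
have ePQ u v : adj u v -> P u -> P v (+) Q v.
  by rewrite /P /Q => /lex_path_adjP[||[]]; lia.
have := nadj_count_from ePQ ps; have := nadj_count_to P Q x s.
have := count_belast P x s; rewrite ls.
have card1 i (iN : i < N) : #|[pred j : 'I_N | nat_of_ord j == i]| = 1.
  by rewrite -(card1 (Ordinal iN)); apply: eq_card => j; rewrite !inE.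
have := count_columns (pred1 0) us fs; rewrite card1 // mul1n.
have := count_columns (pred1 1) us fs; rewrite card1 // mul1n.
move: down; rewrite /P /Q /= y1; lia.
Qed.

Lemma hamiltonian_connected_necessary (k : nat) (H : sgraph) :
    1 <= k -> 0 < #|H| ->
    hamiltonian_connected (lex_product (path_graph (2 * k + 1)) H) ->
  2 <= max_linear_forest H /\ #|H| + 1 <= (k + 1) * max_linear_forest H.
Proof.
move=> k1 H0 hc.
have [c0 c1 c2] : [/\ 0 < 2 * k + 1, 1 < 2 * k + 1 & 2 < 2 * k + 1] by split; lia.
pose i0 : path_graph (2 * k + 1) := Ordinal c0.
pose i1 : path_graph (2 * k + 1) := Ordinal c1.
have lep := max_linear_forest_lt H0.
have [h _] : exists h : H, h \in H by exact/card_gt0P.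
(* For a single vertex, ends in columns 0 and 1 force at least one edge, against [lep]. *)
have [H1|H1] := leqP #|H| 1.
  have [|s hs] := hc (i0, h) (i1, h); first by [].
  have := hamiltonian_path_max_linear_forest c2 _ _ hs.
  by rewrite /column /=; move=> /(_ isT erefl); lia.
have [h' _ hh'] : exists2 h', h' \in H & h' != h.
  have /card_gt0P[h'] : 0 < #|predC1 h| by rewrite cardC1 -ltnS prednK.
  by rewrite !inE; exists h'.
have [|s hs] := hc (i1, h) (i1, h').
  by apply: contra hh' => /eqP[->].
split.
  by have := hamiltonian_path_max_linear_forest c2 _ _ hs; rewrite /column /=; apply.
case: hs => ps ls us fs.
have := count_columns odd us fs; rewrite card_ord_odd.
have := count_columns (fun i => ~~ odd i) us fs; rewrite card_ord_even.
have := nadj_column_sum ps.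
have := nadj_count (fun u : lex_product (path_graph (2 * k + 1)) H =>
  ~~ odd (column u)) (i1, h) s.
have := count_belast (fun u : lex_product (path_graph (2 * k + 1)) H =>
  ~~ odd (column u)) (i1, h) s.
rewrite ls; set S := \sum_(_ < _ | _) _.
have : S <= \sum_(i < 2 * k + 1 | ~~ odd i) max_linear_forest H.
  by apply: leq_sum => i _; apply: nadj_column_leq.
rewrite sum_nat_const card_ord_even.
have -> : count (predC (fun u : lex_product (path_graph (2 * k + 1)) H =>
     ~~ odd (column u))) s = count (fun u => odd (column u)) s.
  by apply: eq_count => u /=; rewrite negbK.
rewrite [_ + false]addn0 [count (fun u => odd _) (_ :: _)]/=.
(* Here [d] and [e] count the steps between even and between odd columns, [c] the vertices in even
   columns and [o] those of [s] in odd columns; the equations give [d = n + 1 + e]. *)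
have num S' p n b c d o e : S' <= k.+1 * p -> b = c -> d + o = b + e -> d <= S' ->
  c = k.+1 * n -> 1 + o = k * n -> n + 1 <= (k + 1) * p by lia.
exact: num.
Qed.

(** * Walks on the path with prescribed numbers of visits *)

Definition unit_step : rel nat := fun i j => (i.+1 == j) || (j.+1 == i).

Lemma path_iota_up (a d : nat) : path unit_step a (iota a.+1 d).
Proof.
by elim: d a => [|d IH] a //=; rewrite IH /unit_step eqxx.
Qed.

Lemma last_iota_up (a d : nat) : last a (iota a.+1 d) = a + d.
Proof. by elim: d a => [|d IH] a /=; rewrite ?addn0 // IH addSnnS. Qed.

Lemma rev_iota_down (a d : nat) : rev (iota a d.+1) = (a + d) :: rev (iota a d).
Proof. by rewrite -addn1 iotaD rev_cat. Qed.

Lemma path_iota_down (a d : nat) : path unit_step (a + d) (rev (iota a d)).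
Proof.
by elim: d => [|d IH] //; rewrite rev_iota_down /= IH /unit_step addnS eqxx orbT.
Qed.

Lemma last_iota_down (a d : nat) : last (a + d) (rev (iota a d)) = a.
Proof. by elim: d => [|d IH]; rewrite ?addn0 // rev_iota_down. Qed.

(* Each [i] in [t] replaces one visit to [i] by [i, i+1, i]. *)
Lemma walk_bounce (a : nat) (c t : seq nat) :
    path unit_step a c -> {subset t <= a :: c} ->
  exists c', [/\ path unit_step a c', last a c' = last a c
    & perm_eq (a :: c') ((a :: c) ++ t ++ map succn t)].
Proof.
move=> pc; elim: t => [|i t IH] sub; first by exists c; rewrite !cats0.
have [j jt|c1 [pc1 lc1 perm1]] := IH; first by apply: sub; rewrite inE jt orbT.
have ic1 : i \in a :: c1.
  by rewrite (perm_mem perm1) mem_cat sub ?inE ?eqxx.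
case/splitPl: ic1 pc1 lc1 perm1 => p1 p2 lp1.
rewrite cat_path last_cat lp1 => /andP[pp1 pp2] lc1 perm1.
exists (p1 ++ [:: i.+1, i & p2]); split.
- by rewrite cat_path pp1 lp1 /= /unit_step !eqxx orbT.
- by rewrite last_cat.
apply/permP => P; move/permP: perm1 => /(_ P).
by rewrite /= !(count_cat, count_map) /= count_cat /= count_map; lia.
Qed.

Lemma count_iota (i a d : nat) : count_mem i (iota a d) = (a <= i < a + d).
Proof. by rewrite count_uniq_mem ?iota_uniq // mem_iota. Qed.

(** The first three terms count the visits of the walk from [a] down to 0, up to [m] and down to
    [b]. Each of the [f i] detours at [i] adds one visit to [i] and one to [i.+1], whence the last
    two terms. *)
Lemma walk_exists (m a b : nat) (f : nat -> nat) : a <= b <= m ->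
  exists c, [/\ path unit_step a c, last a c = b &
    forall i, count_mem i (a :: c) = (0 < i <= a) + (i <= m) + (b <= i < m) +
       (i < m) * f i + (0 < i <= m) * f i.-1].
Proof.
case/andP => ab bm.
pose c0 := rev (iota 0 a) ++ iota 1 m ++ rev (iota b (m - b)).
pose t := flatten [seq nseq (f i) i | i <- iota 0 m].
have ct i : count_mem i t = (i < m) * f i.
  rewrite /t; elim: (m) => [|m' IH]; first by [].
  rewrite -addn1 iotaD map_cat flatten_cat count_cat IH /= cats0 count_nseq /= add0n.
  rewrite [_ + 1]addn1 ltnS.
  by case: (ltngtP i m') => [_|_|->]; rewrite ?mul0n ?mul1n ?addn0.
have cS i : count_mem i [seq j.+1 | j <- t] = (0 < i <= m) * f i.-1.
  rewrite count_map; case: i => [|i].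
    by rewrite (@eq_count _ _ pred0) ?count_pred0.
  by rewrite (@eq_count _ _ (pred1 i)) // ct.
have pc0 : path unit_step a c0.
  rewrite /c0 !cat_path; have := path_iota_down 0 a; rewrite add0n => ->.
  have := last_iota_down 0 a; rewrite add0n => ->.
  rewrite path_iota_up last_iota_up add0n /=.
  by have := path_iota_down b (m - b); rewrite subnKC.
have lc0 : last a c0 = b.
  rewrite /c0 !last_cat; have := last_iota_down 0 a; rewrite add0n => ->.
  by rewrite last_iota_up add0n; have := last_iota_down b (m - b); rewrite subnKC.
have cc0 i : count_mem i (a :: c0) = (0 < i <= a) + (i <= m) + (b <= i < m).
  rewrite /c0 /= !count_cat !(count_rev _ (iota _ _)) !count_iota; lia.
have [||c [pc lc /permP perm]] := @walk_bounce a c0 t; first exact: pc0.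
  move=> i it; rewrite -has_pred1 has_count cc0.
  have : 0 < count_mem i t by rewrite -has_count has_pred1.
  by rewrite ct; case: ltnP => //; lia.
exists c; split; rewrite ?lc // => i.
by rewrite perm !count_cat cc0 ct cS addnA.
Qed.

(** * Distribution of the weights over the even columns *)

Lemma bounded_weights (K p N : nat) (l : nat -> nat) :
    (forall j, l j <= p) -> \sum_(0 <= j < K) l j <= N <= K * p ->
  exists2 s : nat -> nat, forall j, j < K -> l j <= s j <= p
    & \sum_(0 <= j < K) s j = N.
Proof.
move=> lp; elim: K N => [|K IH] N.
  rewrite big_nil mul0n => NE; exists (fun=> 0) => //.
  by rewrite big_nil; lia.
rewrite big_nat_recr //= => bN.
set L := \sum_(_ <= _ < _) _ in bN IH.
(* Greedy choice: the last weight is as large as [p] and the lower bounds of the earlier weights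
   allow. *)
pose q := minn p (N - L).
have [|s sP sN] := IH (N - q).
  have : L <= K * p.
    by rewrite /L -[K in K * p]subn0 -sum_nat_const_nat; apply: leq_sum => j _.
  by have := lp K; rewrite /q; lia.
exists (fun j => if j == K then q else s j) => [j|].
  rewrite ltnS leq_eqVlt => /orP[/eqP ->|jK].
    by rewrite eqxx /q; have := lp K; lia.
  by rewrite (ltn_eqF jK); exact: sP.
rewrite big_nat_recr //= eqxx.
have -> : \sum_(0 <= j < K) (if j == K then q else s j) = N - q.
  by rewrite -sN; apply: eq_big_nat => j /andP[_ jK]; rewrite (ltn_eqF jK).
by rewrite /q; lia.
Qed.

Lemma leq_sum_nat1 (s : nat -> nat) (a b i : nat) :
  a <= i < b -> s i <= \sum_(a <= j < b) s j.
Proof.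
move=> ib; rewrite (bigD1_seq i) ?iota_uniq ?mem_index_iota //=.
exact: leq_addr.
Qed.

Lemma leq_sum_nat2 (s : nat -> nat) (a b i j : nat) :
  a <= i < b -> a <= j < b -> i != j -> s i + s j <= \sum_(a <= l < b) s l.
Proof.
move=> ib jb ij; rewrite (bigD1_seq i) ?iota_uniq ?mem_index_iota //= leq_add2l.
rewrite -big_filter (bigD1_seq j) ?filter_uniq ?iota_uniq //=; first exact: leq_addr.
by rewrite mem_filter mem_index_iota eq_sym ij.
Qed.

Lemma sum_pred1_leq (K i : nat) : \sum_(0 <= j < K) (j == i) <= 1.
Proof.
have [iK|iK] := ltnP i K.
  rewrite (bigD1_seq i) ?iota_uniq ?mem_index_iota //= eqxx.
  by rewrite big1 // => j /negbTE ->.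
by rewrite big_nat big1 // => j jK; case: eqP => // E; lia.
Qed.

(** [S] lists the partial sums of [s]. Its lower bounds come from the weights at [0] and [b./2], its
    upper bounds from those at [k] and [uphalf a], as the weights after [j] sum to [n + 1 - S j]. *)
Lemma column_weights (k a b n p : nat) :
    1 <= k -> a <= b <= 2 * k -> 2 <= p -> p < n -> n + 1 <= (k + 1) * p ->
  exists s S : nat -> nat, (S 0 = s 0 /\ forall j, S j.+1 = S j + s j.+1) /\
    [/\ forall j, j <= k -> (2 * j == a) + (2 * j == b) <= s j <= p,
        forall j, j < k -> 1 + (b <= 2 * j + 1) <= S j,
        forall j, j < k -> S j + (2 * j < a) <= n
      & S k = n + 1].
Proof.
move=> k1 /andP[ab bk] p2 pn npk.
(* These lower bounds keep every detour count in [column_walk] nonnegative. *)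
pose l j := minn 2 ((j == 0) + (j == k) + (j == b./2) + (j == uphalf a)).
have l0 : 0 < l 0 by rewrite leq_min.
have lk : 0 < l k by rewrite leq_min eqxx; do !case: (_ == _).
have lb : 0 < l b./2 by rewrite leq_min eqxx; do !case: (_ == _).
have la : 0 < l (uphalf a) by rewrite leq_min eqxx; do !case: (_ == _).
have lb0 : b./2 = 0 -> 1 < l 0 
  by move=> b0; rewrite leq_min b0 eqxx; do !case: (_ == _).
have lak : uphalf a = k -> 1 < l k 
  by move=> ak; rewrite leq_min ak eqxx; do !case: (_ == _).
have lab j : (2 * j == a) + (2 * j == b) <= l j.
  rewrite mul2n leq_min; case: (j.*2 =P a) => [<-|_]; case: (j.*2 =P b) => [<-|_];
    by rewrite ?uphalf_double ?doubleK ?eqxx; do ?case: (_ == _).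
have [||s sl sN] := @bounded_weights k.+1 p (n + 1) l.
- by move=> j; apply: leq_trans p2; exact: geq_minl.
- apply/andP; split; last by rewrite -[k.+1]addn1.
  (* Each of the four indicators sums to at most 1, and [2 <= p < n] gives [4 <= n + 1]. *)
  apply: (@leq_trans 4); last by move: p2 pn; clear; lia.
  apply: (@leq_trans (\sum_(0 <= j < k.+1)
      ((j == 0) + (j == k) + (j == b./2) + (j == uphalf a)))).
    by apply: leq_sum => j _; exact: geq_minr.
  rewrite !big_split /=.
  by rewrite (@leq_add _ _ 3 1) ?(@leq_add _ _ 2 1) ?(@leq_add _ _ 1 1) ?sum_pred1_leq.
exists s, (fun j => \sum_(0 <= i < j.+1) s i).
split; first by split=> [|j]; rewrite ?big_nat1 // big_nat_recr.
have {}sl j : j <= k -> l j <= s j /\ s j <= p by move=> jk; apply/andP/sl.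
split => //.
- by move=> j /sl[ls ->]; rewrite (leq_trans (lab j) ls).
- move=> j jk; have [ls0 _] := sl 0 isT.
  have s0 := @leq_sum_nat1 s 0 j.+1 0 isT.
  case: (leqP b (2 * j + 1)) => bj; last exact: leq_trans (leq_trans l0 ls0) s0.
  (* When the two indices coincide, the single weight there is at least 2. *)
  have [b0|b0] := eqVneq b./2 0.
    exact: leq_trans (leq_trans (lb0 b0) ls0) s0.
  have bj2 : b./2 <= j by move: bj; clear; lia.
  have [lsb _] := sl _ (leq_trans bj2 (ltnW jk)).
  apply: leq_trans (leq_sum_nat2 s (i := 0) (j := b./2) _ _ _) => //.
    by apply: leq_add; [exact: leq_trans l0 ls0 | exact: leq_trans lb lsb].
  by rewrite eq_sym.
move=> j jk.
have E : \sum_(0 <= i < j.+1) s i + \sum_(j.+1 <= i < k.+1) s i = n + 1.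
  by rewrite -sN -big_cat_nat //= ltnS ltnW.
suff tail : 1 + (2 * j < a) <= \sum_(j.+1 <= i < k.+1) s i.
  move: tail E; move: (2 * j < a : nat) (\sum_(0 <= i < _) _) (\sum_(_ <= i < _) _).
  by clear; lia.
have kr : j.+1 <= k < k.+1 by rewrite jk leqnn.
have sk := leq_sum_nat1 s kr; have [lsk _] := sl k (leqnn _).
case: (ltnP (2 * j) a) => aj; last exact: leq_trans (leq_trans lk lsk) sk.
have [ak|ak] := eqVneq (uphalf a) k; first exact: leq_trans (leq_trans (lak ak) lsk) sk.
have [ar1 ar2] : j < uphalf a /\ uphalf a <= k by move: aj ab bk; clear; lia.
have [lsa _] := sl _ ar2.
apply: leq_trans (leq_sum_nat2 s kr _ _).
- by apply: leq_add; [exact: leq_trans lk lsk | exact: leq_trans la lsa].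
- by rewrite ar1 ltnS.
by rewrite eq_sym.
Qed.

(* [count_mem i (a :: c)] is the number of blocks of column [i]. *)
Lemma column_walk (k a b n p : nat) :
    1 <= k -> a <= b <= 2 * k -> 2 <= p -> p < n -> n + 1 <= (k + 1) * p ->
  exists c : seq nat, [/\ path unit_step a c, last a c = b,
    all (geq (2 * k)) (a :: c)
    & forall i, i <= 2 * k ->
       count_mem i (a :: c) <= n <= count_mem i (a :: c) + p - (i == a) - (i == b)].
Proof.
move=> k1 abk p2 pn npk.
have [s [S [[S0 SS] [sP sL sU sN]]]] := column_weights k1 abk p2 pn npk.
(* [f i] detours [i, i+1, i]: forced recursively by the number of visits wanted
   in columns [0], ..., [i]. *)
pose f i := if odd i then S i./2 - 1 - (b <= i) else n + (a <= i) - S i./2 - 1.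
have [c [pc lc cc]] := walk_exists f abk.
have [ab bk] := andP abk; have ak := leq_trans ab bk.
exists c; split => //.
  apply/allP => i; rewrite -has_pred1 has_count cc /=.
  case: (leqP i (2 * k)) => // ik.
  have -> : (i < 2 * k) = false by rewrite ltnNge (ltnW ik).
  have -> : (i <= a) = false by rewrite leqNgt (leq_ltn_trans ak ik).
  by rewrite !andbF.
have fo j : f (2 * j + 1) = S j - 1 - (b <= 2 * j + 1).
  by rewrite /f mul2n addn1 /= odd_double uphalf_double.
have fe j : f (2 * j) = n + (a <= 2 * j) - S j - 1.
  by rewrite /f mul2n odd_double doubleK.
move=> i ik; rewrite cc.
(* In an odd column [S j] cancels and exactly [n] visits remain; [2 <= p] leaves room for both
   ends. *)
have [oi|ei] := boolP (odd i).
  have [j Ei] : exists j, i = 2 * j + 1.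
    by exists i./2; rewrite -[LHS]odd_double_half oi mul2n addnC.
  rewrite {oi}Ei in ik *.
  have jk : j < k by move: ik; clear; lia.
  have ltk : 2 * j + 1 < 2 * k by move: jk; clear; lia.
  have -> : (2 * j + 1).-1 = 2 * j by rewrite addn1.
  have -> : 0 < 2 * j + 1 by rewrite addn1.
  rewrite ltk ik !mul1n andbT fo fe.
  have -> : (2 * j + 1 <= a) = ~~ (a <= 2 * j) by rewrite addn1 ltnNge.
  move: (sL j jk) (sU j jk) p2; rewrite [2 * j < a]ltnNge.
  move: (S j) (_ == a) (_ == b) (a <= _) (b <= _) => S' d1 d2 da db.
  clear; case: db => /=; case: da => /=; case: d1; case: d2; lia.
have [j Ei] : exists j, i = 2 * j.
  by exists i./2; rewrite -[LHS]odd_double_half (negbTE ei) mul2n.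
rewrite {ei}Ei in ik *.
have jk : j <= k by move: ik; clear; lia.
have [sab sp] := andP (sP j jk).
(* An even column gets [n - s j] visits and one more for each end in it; the bounds on [s j] then
   give both inequalities. *)
suff cnt : (0 < 2 * j <= a) + (2 * j <= 2 * k) + (b <= 2 * j < 2 * k) +
    (2 * j < 2 * k) * f (2 * j) + (0 < 2 * j <= 2 * k) * f (2 * j).-1 + s j
    = n + (2 * j == a) + (2 * j == b).
  move: cnt sab sp; move: (_ + _ * f _.-1) (_ == a) (_ == b) (s j) => r d1 d2 sj.
  by clear; case: d1; case: d2; lia.
rewrite ik fe; case: j ik jk {sab sp} => [|j] ik jk.
  rewrite muln0 /= mul0n muln_gt0 k1 andbT mul1n; move: (sU 0 k1); rewrite muln0 S0.
  rewrite !leqn0 ![0 == _]eq_sym lt0n; move: (s 0) (a == 0) (b == 0) => s0 da db.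
  by clear; case: da; case: db => /=; lia.
have -> : (2 * j.+1).-1 = 2 * j + 1 by clear; lia.
rewrite fo SS; move: (sL j jk).
have -> : (b <= 2 * j + 1) = (b < 2 * j.+1) by clear; lia.
have -> : (0 < 2 * j.+1) by [].
(* No detour starts at column [2 * k]; its count comes out right because [S k = n + 1]. *)
move: jk; rewrite leq_eqVlt => /orP[/eqP jk|jk].
  move: sN ak bk; rewrite -jk SS ltnn andbF mul0n mul1n.
  move: (2 * j.+1) (S j) (s j.+1) => m Sj sj; clear.
  by case: (ltngtP m a) => // _; case: (ltngtP m b) => // _ /=; lia.
move: (sU _ jk); rewrite SS ltn_pmul2l // jk andbT !mul1n.
move: (2 * j.+1) (S j) (s j.+1) => m Sj sj; clear.
by case: (ltngtP m a) => _; case: (ltngtP m b) => _ /=; lia.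
Qed.

(** * Cutting a column into blocks and assigning them to visits *)

Lemma split_blocks (T : Type) (e : rel T) (x : T) (s : seq T) (r : nat) :
    size s < r + nadj e (x :: s) -> r <= (size s).+1 ->
  exists B : seq (seq T), [/\ flatten B = x :: s,
    all (fun t => ~~ nilp t && sorted e t) B & size B = r].
Proof.
elim: s x r => [|y s IH] x r.
  by move=> /= r0 r1; exists [:: [:: x]]; split => //=; lia.
have -> : nadj e [:: x, y & s] = e x y + nadj e (y :: s) by [].
(* [x] is a block by itself if [r - 1] blocks suffice for the rest; otherwise [x] and [y] are
   adjacent and [x] joins the first of [r] blocks. *)
move=> ltr ler; have [ltr'|ger'] := ltnP (size s) (r.-1 + nadj e (y :: s)).
  have [|B [fB aB sB]] := IH y r.-1 ltr'; first by rewrite /= in ler; lia.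
  exists ([:: x] :: B); rewrite /= fB aB sB; split => //.
  by rewrite prednK //; have := nadj_leq_size e y s; move: ltr'; lia.
have exy : e x y by apply: contraLR ltr => /negbTE ->; rewrite -leqNgt [size _]/=; lia.
rewrite exy [size _]/= in ltr ler.
have [||[|[|z t] B] [fB aB sB]] // := IH y r.
- by move: ltr; lia.
- by have := nadj_leq_size e y s; move: ger'; lia.
move: fB aB sB => /= [-> <-] /andP[pB aB] sB.
by exists ([:: x, y & t] :: B); rewrite /= exy pB.
Qed.

(** A single end is placed by a rotation, which destroys only the pair at the cut. For two ends the
    ordering is cut after [x] and after [y] and the three pieces are rearranged, which destroys at
    most two pairs. *)
Lemma ordering_ends (H : sgraph) (P Q : bool) (x y : H) : (P && Q -> x != y) ->
  exists s : seq H, [/\ perm_eq s (enum H),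
    max_linear_forest H <= nadj (@adj H) s + P + Q,
    P -> exists s', s = x :: s' & Q -> exists s', s = rcons s' y].
Proof.
move=> xy; have H0 : 0 < #|H| by apply/card_gt0P; exists x.
have [w [pw ww]] := max_linear_forest_ordering H0.
have wf z : z \in w by rewrite (perm_mem pw) mem_enum.
case: P Q xy => [] [] xy; last by exists w; rewrite pw !addn0.
- have {xy} xy := xy isT.
  (* Reversing [w] if necessary puts [x] before [y]. *)
  wlog [u [v1 [v2 wE]]] : w pw ww wf / exists u v1 v2, w = rcons u x ++ rcons v1 y ++ v2.
    move=> main; have := wf x => /splitPr wE; case: wE pw ww wf => u v pw ww wf.
    have := wf y; rewrite mem_cat inE eq_sym (negbTE xy) /= => /orP[yu|yv]; last first.
      apply: (main (u ++ x :: v)) => //.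
      by case/splitPr: yv => v1 v2; exists u, v1, v2; rewrite !cat_rcons.
    apply: (main (rev (u ++ x :: v))).
    - by rewrite perm_rev.
    - by rewrite nadj_rev //; exact: adj_sym.
    - by move=> z; rewrite mem_rev.
    rewrite rev_cat rev_cons; have : y \in rev u by rewrite mem_rev.
    by case/splitPr => v1 v2; exists (rev v), v1, v2; rewrite !cat_rcons.
  exists (rev (rcons u x) ++ v2 ++ rcons v1 y); split.
  + apply: perm_trans pw; rewrite wE; apply/permP => p.
    by rewrite !count_cat count_rev; lia.
  + move: ww; rewrite wE.
    have := nadj_cat (@adj H) (rcons u x) (rcons v1 y ++ v2).
    have := nadj_cat (@adj H) (rcons v1 y) v2.
    have := nadj_cat (@adj H) (rev (rcons u x)) (v2 ++ rcons v1 y).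
    have := nadj_cat (@adj H) v2 (rcons v1 y).
    by rewrite nadj_rev; [lia | exact: adj_sym].
  + by rewrite rev_rcons; eexists.
  by rewrite -!rcons_cat; eexists.
- have [u [v wE]] : exists u v : seq H, w = u ++ x :: v.
    by case/splitPr: (wf x) => u v; exists u, v.
  rewrite wE in pw ww.
  exists (x :: v ++ u); split => //; [| |by eexists].
  + by apply: perm_trans pw; rewrite -cat_cons perm_catC.
  have := nadj_cat (@adj H) u (x :: v); have := nadj_cat (@adj H) (x :: v) u.
  by move: ww; rewrite cat_cons; lia.
have [u [v wE]] : exists u v : seq H, w = rcons u y ++ v.
  by case/splitPr: (wf y) => u v; exists u, v; rewrite cat_rcons.
rewrite wE in pw ww.
exists (v ++ rcons u y); split => //; [| |by rewrite -rcons_cat; eexists].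
  by apply: perm_trans pw; rewrite perm_catC.
have := nadj_cat (@adj H) v (rcons u y); have := nadj_cat (@adj H) (rcons u y) v.
by move: ww; lia.
Qed.

(** Each prescribed end costs at most one adjacent pair, which the bound on [r] allows for; cutting
    into blocks keeps the ends in place. *)
Lemma column_blocks (H : sgraph) (P Q : bool) (x y : H) (r : nat) :
    (P && Q -> x != y) -> 2 <= max_linear_forest H ->
    r <= #|H| <= r + max_linear_forest H - P - Q ->
  exists B : seq (seq H), [/\ perm_eq (flatten B) (enum H),
    all (fun t => ~~ nilp t && sorted (@adj H) t) B, size B = r,
    P -> exists t B', B = (x :: t) :: B'
    & Q -> exists t B', B = rcons B' (rcons t y)].
Proof.
move=> xy p2 /andP[rn nr].
have [s [ps ws hP hQ]] := ordering_ends xy.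
have : size s = #|H| by rewrite (perm_size ps) -cardE.
case: s ps ws hP hQ => [|z s] ps ws hP hQ sz.
  by have : 0 < #|H| by [apply/card_gt0P; exists x]; rewrite -sz.
have [||B [fB aB sB]] := @split_blocks _ (@adj H) z s r.
- by move: sz nr ws; rewrite [size (_ :: _)]/= => <-; lia.
- by move: sz; rewrite /= => ->.
exists B; rewrite fB; split => //.
  move=> /hP[s' [zx _]]; move: fB aB; rewrite zx.
  by case: (B) => [|[|a t] B'] // [-> _] _; exists t, B'.
move=> /hQ[s' E]; move: fB aB; rewrite E; case/lastP: (B) => [|B' b]; first by case: (s').
rewrite flatten_rcons all_rcons; case/lastP: b => [|t a] //.
by rewrite -rcons_cat => /rcons_inj[_ ->] _; exists t, B'.
Qed.

(** The visits to [i] take the blocks of [B i] in order. Keeping the order puts the first block of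
    the starting column at the start of the walk and the last block of the final column at its
    end. *)
Lemma assign_blocks (I : eqType) (T : Type) (c : seq I) (B : I -> seq T) :
    (forall i, count_mem i c = size (B i)) ->
  exists W : seq (I * T), map fst W = c /\
    forall i, [seq u.2 | u <- W & u.1 == i] = B i.
Proof.
elim: c B => [|j c IH] B cB.
  by exists [::]; split => // i; have := cB i; case: (B i).
case Bj : (B j) => [|t b]; first by have := cB j; rewrite Bj /= eqxx.
have [i|W [Wc WB]] := IH (fun i => if i == j then b else B i).
  have := cB i; rewrite /= eq_sym; case: eqP => [->|_] //.
  by rewrite Bj /= add1n => -[].
exists ((j, t) :: W); split => [|i] /=; first by rewrite Wc.
have := WB i; have [->|ne] := eqVneq i j; first by move=> /= ->.
by [].
Qed.

(** * From walks and blocks to hamiltonian paths *)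

Lemma ord_seq_exists (N : nat) (c : seq nat) :
  all (fun i => i < N) c -> exists w : seq 'I_N, map (@nat_of_ord N) w = c.
Proof.
elim: c => [|i c IH] /=; first by exists [::].
by case/andP => iN /IH[w <-]; exists (Ordinal iN :: w).
Qed.

Definition expand (G H : sgraph) (W : seq (G * seq H)) : seq (lex_product G H) :=
  flatten [seq [seq (u.1, h) | h <- u.2] | u <- W].

Lemma count_expand (G H : sgraph) (W : seq (G * seq H)) (i : G) (h : H) :
  count_mem (i, h) (expand W) =
  count_mem h (flatten [seq u.2 | u <- W & u.1 == i]).
Proof.
elim: W => [|[j t] W IH] //=.
rewrite /expand /= count_cat -/(expand W) IH count_map.
case: eqP => [->|ne] /=.
  by rewrite count_cat; congr (_ + _); apply: eq_count => z /=; rewrite -pair_eqE /= eqxx.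
rewrite (@eq_count _ _ pred0) ?count_pred0 // => z /=.
by rewrite -pair_eqE /=; case: eqP.
Qed.

(** Blocks are paths in their columns, and since they are nonempty, the junction of two blocks joins
    vertices of adjacent columns, all of which are adjacent in the product. *)
Lemma sorted_expand (G H : sgraph) (u : G * seq H) (W : seq (G * seq H)) :
    all (fun v => ~~ nilp v.2 && sorted (@adj H) v.2) (u :: W) ->
    path (@adj G) u.1 (map fst W) ->
  sorted (@adj _) (expand (u :: W)).
Proof.
have blk i (h : H) t : path (@adj H) h t ->
    path (@adj (lex_product G H)) (i, h) [seq (i, z) | z <- t].
  by elim: t h => [|z t IH] h //= /andP[hz /IH ->]; rewrite /adj /= /lex_adj eqxx /= hz orbT.
elim: W u => [|[j s] W IH] [i [|h t]] //= /andP[].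
  by move=> pt _ _; rewrite /expand /= cats0; exact: blk.
move=> pt aW /andP[ij pW]; have := IH (j, s) aW pW.
case: s {IH} aW => [|z s] //= aW.
rewrite /expand /= => sW; rewrite cat_path.
apply/andP; split; first exact: blk.
apply/andP; split; last exact: sW.
by rewrite (last_map (fun z => (i, z))) /adj /= /lex_adj /= ij.
Qed.

Lemma hamiltonian_path_rev (G : sgraph) (x y : G) (p : seq G) :
  hamiltonian_path x y p -> exists q, hamiltonian_path y x q.
Proof.
case=> pp <- up fp; exists (rev (belast x p)).
have E : last x p :: rev (belast x p) = rev (x :: p) by rewrite [in RHS]lastI rev_rcons.
split.
- by rewrite rev_path (eq_path (e' := @adj G)) // => a b; rewrite adj_sym.
- by rewrite -[LHS]/(last (last x p) (last x p :: _)) E rev_cons last_rcons.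
- by rewrite E rev_uniq.
by move=> z; rewrite E mem_rev.
Qed.

Lemma lex_path_hamiltonian (k : nat) (H : sgraph) (a b : 'I_(2 * k + 1)) (x y : H) :
    1 <= k -> 2 <= max_linear_forest H ->
    #|H| + 1 <= (k + 1) * max_linear_forest H ->
    a <= b -> (a = b -> x != y) ->
  exists p, @hamiltonian_path (lex_product (path_graph (2 * k + 1)) H) (a, x) (b, y) p.
Proof.
move=> k1 p2 npk ab xy.
have pn : max_linear_forest H < #|H|.
  by apply: max_linear_forest_lt; apply/card_gt0P; exists x.
have ordk (i : 'I_(2 * k + 1)) : i <= 2 * k by case: i => i /=; lia.
have abk : a <= b <= 2 * k by rewrite ab; exact: ordk.
have [c [pc lc ac cc]] := column_walk k1 abk p2 pn npk.
have [w wE] : exists w : seq 'I_(2 * k + 1), map (@nat_of_ord _) w = nat_of_ord a :: c.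
  apply: ord_seq_exists; apply: sub_all ac => i /=; lia.
(* The first block of column [a] has to begin with [x] and the last block of column [b] to end with
   [y]. *)
have /fin_all_exists[B BP] : forall i : 'I_(2 * k + 1), exists B : seq (seq H),
   [/\ perm_eq (flatten B) (enum H),
    all (fun t => ~~ nilp t && sorted (@adj H) t) B, size B = count_mem i w,
    i == a -> exists t B', B = (x :: t) :: B'
    & i == b -> exists t B', B = rcons B' (rcons t y)].
  move=> i; apply: column_blocks => //.
    by case/andP => /eqP ia /eqP ib; apply: xy; rewrite -ia ib.
  have -> : count_mem i w = count_mem (nat_of_ord i) (nat_of_ord a :: c).
    by rewrite -wE count_map; apply: eq_count.
  exact: cc (ordk i).
have [|W [Ww WB]] := @assign_blocks _ _ w B; first by move=> i; case: (BP i) => _ _ ->.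
have aB u : u \in W -> ~~ nilp u.2 && sorted (@adj H) u.2.
  move=> uW; case: (BP u.1) => _ /allP + _ _ _; apply.
  by rewrite -WB; apply/mapP; exists u => //; rewrite mem_filter eqxx.
pose ex := @expand (path_graph (2 * k + 1)) H.
(* Multiplicity one yields both spanning and absence of repetitions. *)
have countW i h : count_mem (i, h) (ex W) = 1.
  rewrite count_expand; case: (BP i) => /permP perm _ _ _ _.
  by rewrite WB perm count_uniq_mem ?enum_uniq // mem_enum.
have memW u : u \in ex W by case: u => i h; rewrite -has_pred1 has_count countW.
have uniqW : uniq (ex W).
  by apply: count_mem_uniq => -[i h]; rewrite countW memW.
(* The walk ends in [b], so the last entry of [W] is the last visit to column [b] and carries its
   last block. *)
have lastW : exists q, ex W = rcons q (b, y).
  case/lastP: W Ww WB {aB countW memW uniqW} => [|W [b' t]]; first by case: (w) wE.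
  rewrite map_rcons => /= Ww; have : b' = b.
    apply: val_inj; have := congr1 (last (nat_of_ord a)) wE.
    by rewrite /= lc -Ww map_rcons last_rcons.
  move=> -> /(_ b); case: (BP b) => _ _ _ _ /(_ (eqxx _))[t' [B' ->]].
  rewrite filter_rcons /= eqxx map_rcons => /rcons_inj[_ /= ->].
  by rewrite /ex /expand map_rcons flatten_rcons /= map_rcons -rcons_cat; eexists.
have headW : exists t W', W = (a, x :: t) :: W' /\ path (@path_adj _) a (map fst W').
  case: W Ww WB {aB countW memW uniqW lastW} => [|[a' t] W]; first by case: (w) wE.
  case: (w) wE => // a'' w' [/val_inj -> wc] [-> Ww].
  move=> /(_ a); case: (BP a) => _ _ _ /(_ (eqxx _))[t' [B' ->]] _.
  rewrite /= eqxx /= => -[-> _]; exists t', W; split=> //.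
  by move: pc; rewrite -wc -Ww path_map.
have [t [W' [WE pW']]] := headW; rewrite WE in aB uniqW memW lastW.
exists (behead (ex W)); rewrite WE /ex /expand /= .
split.
- apply: (@sorted_expand (path_graph (2 * k + 1)) H (a, x :: t) W') => //.
  by apply/allP.
- have [q qE] := lastW; have := congr1 (last (a, x)) qE.
  by rewrite last_rcons.
- exact: uniqW.
exact: memW.
Qed.

Lemma hamiltonian_connected_sufficient (k : nat) (H : sgraph) :
    1 <= k -> 2 <= max_linear_forest H ->
    #|H| + 1 <= (k + 1) * max_linear_forest H ->
  hamiltonian_connected (lex_product (path_graph (2 * k + 1)) H).
Proof.
move=> k1 p2 npk [a x] [b y] xy.
have [ab|/ltnW ba] := leqP (nat_of_ord a) (nat_of_ord b).
  by apply: lex_path_hamiltonian => // E; apply: contra xy => /eqP ->; rewrite E.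
(* For ends in the opposite order, the path is built from [y] to [x] and reversed. *)
have [|p] := lex_path_hamiltonian k1 p2 npk ba (x := y) (y := x).
  by move=> E; apply: contra xy => /eqP ->; rewrite E.
exact: hamiltonian_path_rev.
Qed.

Theorem theorem8 (k : nat) (H : sgraph) (hk : 1 <= k) (hH : 0 < #|H|) :
  hamiltonian_connected (lex_product (path_graph (2 * k + 1)) H) <->
  (2 <= max_linear_forest H /\
   (Num.ceil ((#|H| + 1)%N%:R / (max_linear_forest H)%:R : rat)
      <= (k + 1)%N%:Z)%R).
Proof.
(* An integer bounds the ceiling exactly when it bounds the quotient. The premise makes the
   denominator positive, so that it can be cleared; division by 0 has the default value 0. *)
have ceilE : 2 <= max_linear_forest H ->
    (Num.ceil ((#|H| + 1)%N%:R / (max_linear_forest H)%:R : rat) <= (k + 1)%N%:Z)%R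
    = (#|H| + 1 <= (k + 1) * max_linear_forest H).
  move=> p2.
  rewrite Num.Theory.ceil_le_int Num.Theory.ler_pdivrMr.
    by rewrite -[((k + 1)%:Z)%:~R%R]/(((k + 1)%:R)%R) -GRing.natrM Num.Theory.ler_nat.
  by rewrite Num.Theory.ltr0n; lia.
split => [hc|[p2]].
  by have [p2 np] := hamiltonian_connected_necessary hk hH hc; rewrite ceilE.
by rewrite ceilE //; exact: hamiltonian_connected_sufficient.
Qed.
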